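(* Let $\Gamma=(V,E)$ be a finite unoriented graph without loops and multiple edges, for each $v\in V$ let $G_v$ be a countable group with a length function $L_v$, and let $G=\prod_\Gamma G_v$ be the graph product, equipped with the length function $L$ defined by $L(g)=\sum_{i=1}^m L_{v_i}(g_{v_i})+\lambda(g)$ for any reduced representation $g=g_{v_1}\cdots g_{v_m}$. Let $\mathcal{C}$ be the set of all cliques of $\Gamma$. Then $G$ has the relative centroid property with respect to the clique subgroups $G_C$, $C\in\mathcal{C}$.
   Context: All polynomials are assumed to have non-negative coefficients. A length function on a group is a map $L$ to $[0,\infty)$ with $L(gh)\le L(g)+L(h)$, $L(g)=L(g^{-1})$, $L(1)=0$. Graph product: $\prod_\Gamma G_v$ is the quotient of the free product of the groups $G_v$, $v\in V$, by the normal subgroup generated by all commutators $[g_1,g_2]$ with $g_1\in G_{v_1}$, $g_2\in G_{v_2}$, $(v_1,v_2)\in E$. Every $g\in G$ is a product of syllables $g=g_{v_1}\cdots g_{v_m}$ with $g_{v_i}\in G_{v_i}$, $v_i\neq v_{i+1}$; the minimal such $m$ is the syllable length $\lambda(g)$, and a representation with $m=\lambda(g)$ is called reduced. Any two reduced representations of $g$ differ only by the order of the syllables, so $L$ is well defined. A clique of $\Gamma$ is a subset of $V$ in which each pair of distinct vertices is connected by an edge. For $C\in\mathcal{C}$ the clique subgroup $G_C$ is the subgroup of $G$ generated by the $G_v$, $v\in C$ (it is the direct product of these $G_v$). Put $\mathrm{dist}(a,b)=L(a^{-1}b)$ on $G$. $G$ has the relative centroid property with respect to subgroups $H_1,\dots,H_m$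 if it has the relative centroid property with centroid space $X=G$ (on which $G$ acts by left multiplication) and the sets of triples $T_i=G\cdot H_i^3=\{(gh_1,gh_2,gh_3): g\in G,\ h_1,h_2,h_3\in H_i\}\subseteq X^3$; that is, if there are a map $\mathfrak{rc}\colon G^2\to\bigcup_{i=1}^m T_i$ and a polynomial $P$ such that for all $r>0$: ($rc_1$) for every $k\in G$ the number of pairs $(\alpha,\gamma)\in X^2$ such that $\mathfrak{rc}(g,k)=(\alpha,\beta,\gamma)$ for some $g\in G$ with $L(g)\le r$ and some $\beta\in X$ is at most $P(r)$; ($rc_2$) for every $g\in G$ the number of pairs $(\alpha,\beta)\in X^2$ such that $\mathfrak{rc}(g,k)=(\alpha,\beta,\gamma)$ for some $k\in G$, $\gamma\in X$ is at most $P(L(g))$; ($rc_3$) for every $h\in G$ the number of pairs in $X^2$ of the form $g^{-1}\cdot(\beta,\gamma)$, where $g\in G$, $L(g)\le r$ and $\mathfrak{rc}(g,gh)=(\alpha,\beta,\gamma)$ for some $\alpha\in X$, is at most $P(r)$; ($rc_4$) for all $g,k\in G$, if $(\alpha,\beta,\gamma)=\mathfrak{rc}(g,k)$, then $\mathrm{dist}(\alpha,\beta)\le P(L(g))$, $\mathrm{dist}(\alpha,\gamma)\le P(L(k))$, $\mathrm{dist}(\beta,\gamma)\le P(L(g^{-1}k))$. *)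

(* Defs.v *)
From HB Require Import structures.
From mathcomp Require Import all_boot all_order all_algebra finmap.
From mathcomp Require Import boolp classical_sets functions cardinality reals.
From mathcomp Require Import generic_quotient.

Set Implicit Arguments.
Unset Strict Implicit.
Unset Printing Implicit Defensive.

Import Order.TTheory GRing.Theory Num.Theory.

Local Open Scope classical_set_scope.
Local Open Scope quotient_scope.
Local Open Scope group_scope.

Definition subgroup (G : groupType) (H : set G) : Prop :=
  [/\ H 1, {in H &, forall x y, H (x * y)} & {in H, forall x, H x^-1}].

Definition normal_subgroup (G : groupType) (N : set G) : Prop :=
  subgroup N /\ forall x y, N x -> N (x ^ y).

Definition subgroup_generated (G : groupType) (S : set G) : set G :=
  smallest (@subgroup G) S.

Definition normal_closure (G : groupType) (S : set G) : set G :=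
  smallest (@normal_subgroup G) S.

Lemma subgroup_generated_subgroup (G : groupType) (S : set G) :
  subgroup (subgroup_generated S).
Proof.
split.
- by move=> H [[]].
- move=> x y /set_mem Hx /set_mem Hy H HS.
  by have [[_ M _] _] := HS; apply: M; rewrite inE; [apply: Hx|apply: Hy].
- move=> x /set_mem Hx H HS.
  by have [[_ _ I] _] := HS; apply: I; rewrite inE; apply: Hx.
Qed.

Lemma normal_closure_normal (G : groupType) (S : set G) :
  normal_subgroup (normal_closure S).
Proof.
split; first split.
- by move=> N [[[]]].
- move=> x y /set_mem Nx /set_mem Ny N NN.
  have [[[_ M _] _] _] := NN.
  by apply: M; rewrite inE; [apply: Nx|apply: Ny].
- move=> x /set_mem Nx N NN.
  by have [[[_ _ I] _] _] := NN; apply: I; rewrite inE; apply: Nx.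
- by move=> x y Nx N NN; have [[_ J] _] := NN; apply: J; apply: Nx.
Qed.

(* [quotient_group S] is the quotient of [G] by the normal closure of [S]. *)
Section QuotientGroup.
Variables (G : groupType) (S : set G).
Implicit Types x y z : G.

Let N := normal_closure S.
Let N1 : N 1.
Proof. by have [[]] := normal_closure_normal S. Qed.
Let NM x y : N x -> N y -> N (x * y).
Proof.
have [[_ M _] _] := normal_closure_normal S.
by move=> Nx Ny; apply: M; rewrite inE.
Qed.
Let NV x : N x -> N x^-1.
Proof.
by have [[_ _ I] _] := normal_closure_normal S => Nx; apply: I; rewrite inE.
Qed.
Let NJ x y : N x -> N (x ^ y).
Proof. by have [_] := normal_closure_normal S; apply. Qed.

Definition ncl_rel : rel G := fun x y => `[< normal_closure S (x^-1 * y) >].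

Lemma ncl_rel_refl : reflexive ncl_rel.
Proof. by move=> x; apply/asboolP; rewrite mulVg. Qed.

Lemma ncl_rel_sym : symmetric ncl_rel.
Proof.
by move=> x y; apply/asboolP/asboolP => /NV; rewrite invgM invgK.
Qed.

Lemma ncl_rel_trans : transitive ncl_rel.
Proof.
move=> y x z /asboolP xy /asboolP yz; apply/asboolP.
by have := NM xy yz; rewrite -mulgA mulVKg.
Qed.

Canonical ncl_equiv := EquivRel ncl_rel ncl_rel_refl ncl_rel_sym ncl_rel_trans.

Definition quotient_group := {eq_quot ncl_rel}.
HB.instance Definition _ := Choice.on quotient_group.
HB.instance Definition _ := EqQuotient.on quotient_group.

Definition quotient_proj (x : G) : quotient_group := \pi x.

Lemma quotient_projP x y :
  quotient_proj x = quotient_proj y <-> normal_closure S (x^-1 * y).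
Proof.
by split=> [/eqP|h]; [rewrite eqmodE => /asboolP|apply/eqP; rewrite eqmodE; apply/asboolP].
Qed.

Definition quotient_mul (x y : quotient_group) : quotient_group :=
  quotient_proj (repr x * repr y).
Definition quotient_inv (x : quotient_group) : quotient_group :=
  quotient_proj (repr x)^-1.

Lemma quotient_reprK (x : quotient_group) : quotient_proj (repr x) = x.
Proof. exact: reprK. Qed.

Lemma quotient_projM x y :
  quotient_proj (x * y) = quotient_mul (quotient_proj x) (quotient_proj y).
Proof.
apply/esym/quotient_projP; set x' := repr _; set y' := repr _.
have /quotient_projP hx : quotient_proj x' = quotient_proj x by exact: reprK.
have /quotient_projP hy : quotient_proj y' = quotient_proj y by exact: reprK.
have -> : (x' * y')^-1 * (x * y) = (x'^-1 * x) ^ y' * (y'^-1 * y).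
  by rewrite invgM conjgE !mulgA mulgK.
exact: NM (NJ _ hx) hy.
Qed.

Lemma quotient_projV x : quotient_proj x^-1 = quotient_inv (quotient_proj x).
Proof.
apply/esym/quotient_projP; set x' := repr _.
have /quotient_projP hx : quotient_proj x' = quotient_proj x by exact: reprK.
have -> : x'^-1^-1 * x^-1 = ((x'^-1 * x) ^ x'^-1)^-1.
  by rewrite conjgE !invgM !invgK !mulgA mulgK.
exact: NV (NJ _ hx).
Qed.

Fact quotient_mulA : associative quotient_mul.
Proof.
move=> x y z; rewrite -(quotient_reprK x) -(quotient_reprK y).
by rewrite -(quotient_reprK z) -!quotient_projM mulgA.
Qed.

Fact quotient_mul1 : left_id (quotient_proj 1) quotient_mul.
Proof.
by move=> x; rewrite -(quotient_reprK x) -!quotient_projM mul1g.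
Qed.

Fact quotient_mulg1 : right_id (quotient_proj 1) quotient_mul.
Proof.
by move=> x; rewrite -(quotient_reprK x) -!quotient_projM mulg1.
Qed.

Fact quotient_mulV : left_inverse (quotient_proj 1) quotient_inv quotient_mul.
Proof.
move=> x; rewrite -(quotient_reprK x) -quotient_projV -quotient_projM.
by rewrite mulVg.
Qed.

Fact quotient_mulgV : right_inverse (quotient_proj 1) quotient_inv quotient_mul.
Proof.
move=> x; rewrite -(quotient_reprK x) -quotient_projV -quotient_projM.
by rewrite mulgV.
Qed.

HB.instance Definition _ := isGroup.Build quotient_group
  quotient_mulA quotient_mul1 quotient_mulg1 quotient_mulV quotient_mulgV.

End QuotientGroup.

Section FreeProduct.
Variables (V : finType) (G : V -> groupType).

(* Words in the disjoint union of the groups [G v]. *)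
Definition word := seq {v : V & G v}.

HB.instance Definition _ := Choice.on word.

Inductive word_cong : word -> word -> Prop :=
| WordRefl w : word_cong w w
| WordSym w1 w2 : word_cong w1 w2 -> word_cong w2 w1
| WordTrans w1 w2 w3 : word_cong w1 w2 -> word_cong w2 w3 -> word_cong w1 w3
| WordCat w1 w2 w1' w2' :
    word_cong w1 w1' -> word_cong w2 w2' -> word_cong (w1 ++ w2) (w1' ++ w2')
| WordUnit v : word_cong [:: Tagged G (1 : G v)] [::]
| WordMul v (a b : G v) :
    word_cong [:: Tagged G a; Tagged G b] [:: Tagged G (a * b)].

Definition word_rel : rel word := fun w1 w2 => `[< word_cong w1 w2 >].

Lemma word_rel_refl : reflexive word_rel.
Proof. by move=> w; apply/asboolP; constructor. Qed.

Lemma word_rel_sym : symmetric word_rel.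
Proof. by move=> x y; apply/asboolP/asboolP; apply: WordSym. Qed.

Lemma word_rel_trans : transitive word_rel.
Proof.
by move=> y x z /asboolP xy /asboolP yz; apply/asboolP; apply: WordTrans yz.
Qed.

Canonical word_equiv := EquivRel word_rel word_rel_refl word_rel_sym word_rel_trans.

Definition free_product := {eq_quot word_rel}.
HB.instance Definition _ := Choice.on free_product.
HB.instance Definition _ := EqQuotient.on free_product.

Definition fp_class (w : word) : free_product := \pi w.

Lemma fp_classP w1 w2 : fp_class w1 = fp_class w2 <-> word_cong w1 w2.
Proof.
by split=> [/eqP|h]; [rewrite eqmodE => /asboolP|apply/eqP; rewrite eqmodE; apply/asboolP].
Qed.

Definition word_inv (w : word) : word :=
  rev [seq Tagged G (tagged s)^-1 | s : {v : V & G v} <- w].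

Definition fp_mul (x y : free_product) : free_product :=
  fp_class (repr x ++ repr y).
Definition fp_inv (x : free_product) : free_product :=
  fp_class (word_inv (repr x)).

Lemma fp_reprK (x : free_product) : fp_class (repr x) = x.
Proof. exact: reprK. Qed.

Lemma fp_classM w1 w2 : fp_class (w1 ++ w2) = fp_mul (fp_class w1) (fp_class w2).
Proof. by apply/esym/fp_classP/WordCat; apply/fp_classP; exact: reprK. Qed.

Lemma word_inv_cong w1 w2 :
  word_cong w1 w2 -> word_cong (word_inv w1) (word_inv w2).
Proof.
rewrite /word_inv; elim=> {w1 w2}.
- by move=> w; apply: WordRefl.
- by move=> w1 w2 _; apply: WordSym.
- by move=> w1 w2 w3 _ h1 _; apply: WordTrans h1.
- by move=> *; rewrite !map_cat !rev_cat; apply: WordCat.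
- by move=> v; rewrite /= invg1; apply: WordUnit.
- by move=> v a b; rewrite /rev /= invgM; apply: WordMul.
Qed.

Lemma word_mulV w : word_cong (word_inv w ++ w) [::].
Proof.
elim: w => [|[v a] w IH]; first exact: WordRefl.
rewrite /word_inv /= rev_cons cat_rcons.
apply: WordTrans IH; apply: WordCat; first exact: WordRefl.
rewrite -[[:: _, _ & w]]/([:: Tagged G a^-1; Tagged G a] ++ w) -[w in X in word_cong _ X]cat0s.
apply: WordCat; last exact: WordRefl.
by apply: WordTrans (WordMul _ _) _; rewrite mulVg; apply: WordUnit.
Qed.

Lemma word_invK : involutive word_inv.
Proof.
move=> w; rewrite /word_inv map_rev revK -map_comp -[RHS]map_id.
by apply: eq_map => -[v a] /=; rewrite invgK.
Qed.

Lemma fp_classV w : fp_class (word_inv w) = fp_inv (fp_class w).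
Proof.
by apply/esym/fp_classP/word_inv_cong; apply/fp_classP; exact: reprK.
Qed.

Fact fp_mulA : associative fp_mul.
Proof.
move=> x y z; rewrite -(fp_reprK x) -(fp_reprK y) -(fp_reprK z).
by rewrite -!fp_classM catA.
Qed.

Fact fp_mul1 : left_id (fp_class [::]) fp_mul.
Proof. by move=> x; rewrite -(fp_reprK x) -fp_classM. Qed.

Fact fp_mulg1 : right_id (fp_class [::]) fp_mul.
Proof. by move=> x; rewrite -(fp_reprK x) -fp_classM cats0. Qed.

Fact fp_mulV : left_inverse (fp_class [::]) fp_inv fp_mul.
Proof.
move=> x; rewrite -(fp_reprK x) -fp_classV -fp_classM.
exact/fp_classP/word_mulV.
Qed.

Fact fp_mulgV : right_inverse (fp_class [::]) fp_inv fp_mul.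
Proof.
move=> x; rewrite -(fp_reprK x) -fp_classV -fp_classM; apply/fp_classP.
by rewrite -{1}(word_invK (repr x)); apply: word_mulV.
Qed.

HB.instance Definition _ := isGroup.Build free_product
  fp_mulA fp_mul1 fp_mulg1 fp_mulV fp_mulgV.

Definition fp_incl (v : V) (a : G v) : free_product := fp_class [:: Tagged G a].

End FreeProduct.

Section GraphProduct.
Variables (V : finType) (E : rel V) (G : V -> groupType).

Definition edge_commutators : set (free_product G) :=
  [set x | exists (v1 v2 : V) (g1 : G v1) (g2 : G v2),
    E v1 v2 /\ x = [~ fp_incl g1, fp_incl g2]].

Definition graph_product := quotient_group edge_commutators.

HB.instance Definition _ := Group.on graph_product.

Definition gp_incl (v : V) (a : G v) : graph_product :=
  quotient_proj edge_commutators (fp_incl a).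

Definition word_prod (w : word G) : graph_product :=
  \prod_(s <- w) gp_incl (tagged s).

Definition represents (w : word G) (g : graph_product) : Prop :=
  sorted (fun s t => tag s != tag t) w /\ word_prod w = g.

Lemma gp_incl1 v : gp_incl (1 : G v) = 1.
Proof.
rewrite /gp_incl (_ : fp_incl _ = 1) //.
exact/fp_classP/WordUnit.
Qed.

Lemma gp_inclM v (a b : G v) : gp_incl (a * b) = gp_incl a * gp_incl b.
Proof.
rewrite [RHS](_ : _ = quotient_proj edge_commutators (fp_incl a * fp_incl b)).
  congr quotient_proj; rewrite [RHS](_ : _ = fp_class ([:: Tagged G a] ++ [:: Tagged G b])).
    exact/esym/fp_classP/WordMul.
  by rewrite fp_classM.
by rewrite quotient_projM.
Qed.

Lemma word_prod_surj (g : graph_product) : exists w, word_prod w = g.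
Proof.
exists (repr (repr g)); rewrite -[RHS]quotient_reprK -[X in _ = quotient_proj _ X]fp_reprK.
elim: (repr (repr g)) => [|[v a] w IH]; first by rewrite /word_prod big_nil.
rewrite /word_prod big_cons -/(word_prod w) IH /=.
by rewrite -[Tagged _ _ :: w]cat1s fp_classM quotient_projM.
Qed.

Lemma represents_exists (g : graph_product) : exists w, represents w g.
Proof.
have [w <-] := word_prod_surj g.
elim: w => [|[v a] w [w' [sw' pw']]]; first by exists [::].
have -> : word_prod (existT _ v a :: w) = gp_incl a * word_prod w.
  by rewrite /word_prod big_cons.
rewrite -pw'; case: w' sw' {pw'} => [|[u b] w'] /= sw'.
  by exists [:: Tagged G a]; split => //; rewrite /word_prod big_cons.
have [uv|nuv] := eqVneq v u; last first.
  exists [:: Tagged G a, Tagged G b & w']; split; first by rewrite /= nuv.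
  by rewrite /word_prod big_cons.
case: _ / uv b sw' => b sw'.
exists (Tagged G (a * b) :: w'); split; first by case: w' sw'.
by rewrite /word_prod !big_cons /= gp_inclM mulgA.
Qed.

Lemma syllable_length_subproof (g : graph_product) :
  exists m, `[< exists w, represents w g /\ size w = m >].
Proof.
by have [w wg] := represents_exists g; exists (size w); apply/asboolP; exists w.
Qed.

Definition syllable_length (g : graph_product) : nat :=
  ex_minn (syllable_length_subproof g).

Definition reduced (w : word G) (g : graph_product) : Prop :=
  represents w g /\ size w = syllable_length g.

Lemma reduced_exists (g : graph_product) : exists w, reduced w g.
Proof.
by rewrite /reduced /syllable_length; case: ex_minnP => m /asboolP[w []]; exists w.
Qed.

Definition reduced_word (g : graph_product) : word G :=
  projT1 (cid (reduced_exists g)).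

Definition clique (C : {set V}) : bool :=
  [forall u in C, forall v in C, (u != v) ==> E u v].

Definition clique_subgroup (C : {set V}) : set graph_product :=
  subgroup_generated
    [set g | exists2 v : V, v \in C & exists a : G v, g = gp_incl a].

End GraphProduct.

Section Lengths.
Local Open Scope ring_scope.
Variable R : realType.

Definition length_function (G : groupType) (L : G -> R) : Prop :=
  [/\ forall g, 0 <= L g,
      forall g h, L (g * h)%g <= L g + L h,
      forall g, L g^-1%g = L g &
      L 1%g = 0].

(* The value does not depend on the choice of the reduced representation,
   since two reduced representations differ only by the order of syllables. *)
Definition graph_length (V : finType) (E : rel V) (G : V -> groupType)
    (L : forall v, G v -> R) (g : graph_product E G) : R :=
  \sum_(s <- reduced_word g) L (tag s) (tagged s) + (syllable_length g)%:R.

Definition card_at_most (T : choiceType) (A : set T) (x : R) : Prop :=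
  finite_set A /\ (#|` fset_set A|)%:R <= x.

Definition nonneg_coefs (P : {poly R}) : Prop := forall i, 0 <= P`_i.

Section RelativeCentroid.
Variables (G : groupType) (L : G -> R).

Definition dist (a b : G) : R := L (a^-1 * b)%g.

Definition coset_triples (H : set G) : set (G * G * G) :=
  [set t | exists g h1 h2 h3, [/\ H h1, H h2, H h3 &
     t = ((g * h1)%g, (g * h2)%g, (g * h3)%g)]].

Definition relative_centroid_property (I : finType) (H : I -> set G) : Prop :=
  exists (rc : G -> G -> G * G * G) (P : {poly R}),
  [/\ nonneg_coefs P,
      forall g k, (\bigcup_(i in [set: I]) coset_triples (H i)) (rc g k) &
      forall r : R, 0 < r ->
      [/\ forall k, card_at_most
            [set p : G * G | exists g b, L g <= r /\ rc g k = (p.1, b, p.2)]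
            P.[r],
          forall g, card_at_most
            [set p : G * G | exists k c, rc g k = (p.1, p.2, c)]
            P.[L g],
          forall h, card_at_most
            [set p : G * G | exists g a b c,
               [/\ L g <= r, rc g (g * h)%g = (a, b, c) &
                   p = ((g^-1 * b)%g, (g^-1 * c)%g)]]
            P.[r] &
          forall g k a b c, rc g k = (a, b, c) ->
            [/\ dist a b <= P.[L g],
                dist a c <= P.[L k] &
                dist b c <= P.[L (g^-1 * k)%g]]]].

End RelativeCentroid.
End Lengths.

(* Main.v *)
Require Import Defs.
From HB Require Import structures.
From mathcomp Require Import all_boot all_order all_algebra finmap.
From mathcomp Require Import boolp classical_sets functions cardinality reals.

Set Implicit Arguments.
Unset Strict Implicit.
Unset Printing Implicit Defensive.

Import Order.TTheory GRing.Theory Num.Theory.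

Local Open Scope classical_set_scope.

(** Two elements g and k of the graph product have a
    longest common prefix a.  Cancel it: g = a g', k = a k'.  Let C be the set
    of vertices at which both g' and k' can start with a syllable.  Initial
    syllables of one element commute, so C is a clique, and g' = x b, k' = y c
    where x and y are products over C.  The syllables of x and y at a vertex of
    C differ, since a is maximal, so z = x^-1 y has a nontrivial syllable at
    every vertex of C, and the word for b^-1 z c is again reduced: a merge of
    a syllable of b with one of c would have to pass through z, hence happen at
    a vertex adjacent to all of C where both g' and k' start, and such a vertex
    would be in C.  This is [centroid_decomposition]; the centroid of (g, k) is
    the triple (a, a x, a y), which lies in a G_C^3.

    All the pairs that have to be counted consist of prefixes of one element:
    a and a x are prefixes of g, a and a y are prefixes of k, and
    g^-1 a x = b^-1 and g^-1 a y = b^-1 z are prefixes of g^-1 k.  All of them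
    have at most lambda(g) <= L(g) syllables.  A prefix of a given element is
    determined by the number of its syllables at each vertex
    ([prefix_unique]), so there are at most (n + 1)^|V| prefixes of syllable
    length at most n ([prefixes_enum]) and the pairs are bounded by
    (r + 1)^(2 |V|).  The three distances are L(x), L(y) and L(z), where x, y, z
    are factors of reduced words for g, k and g^-1 k.

    Everything rests on the normal form theorem for graph products: a word
    of nontrivial syllables without possible merges is reduced, and two such
    words for one element differ by shuffling.  It is proved by letting the graph product act on
    piles ([act_word_prod]), and the pile of such a word, its image of the
    empty pile, is then an invariant of the element
    ([irreducible_pile_eq]). *)

(** * Stacks and the action of the vertex groups *)

Section Piles.
Local Open Scope group_scope.
Variables (V : finType) (E : rel V) (G : V -> groupType).
Hypotheses (E_sym : symmetric E) (E_irr : irreflexive E).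

Notation syllable := {v : V & G v}.
Notation pile := (V -> seq (option syllable)).
Implicit Types (p : pile) (u v : V) (s : syllable) (w : word G).

(** A pile is a family of stacks, one for each vertex.  A syllable at v is
    recorded on stack v and leaves a marker [None] on the stacks of the other
    vertices not adjacent to v, so that the stack at u shows on its top whether
    a syllable at u can be brought to the front. *)
Definition push v (a : G v) p : pile :=
  if a == 1 then p else fun u =>
  if E u v then p u else (if u == v then Some (Tagged G a) else None) :: p u.

Definition unblocked v p : bool :=
  if p v is Some _ :: _ then false else true.

(** The initial syllable at v, with the value 1 when there is none; this
    convention makes [p = push (top v p) (pop v p)] hold for valid piles. *)
Definition top v p : G v :=
  if p v is Some s :: _ then tagged_as (Tagged G (1 : G v)) s else 1.

Definition pop v p : pile :=
  if unblocked v p then p else fun u => if E u v then p u else behead (p u).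

Definition act v (a : G v) p : pile := push (a * top v p) (pop v p).

(** The piles of reduced words, built without reference to words. *)
Inductive valid : pile -> Prop :=
| valid_nil : valid (fun=> [::])
| valid_push v (a : G v) p : valid p -> unblocked v p -> valid (push a p).

Lemma push1 v p : push (1 : G v) p = p.
Proof. by rewrite /push eqxx. Qed.

Lemma pushE v (a : G v) p u : a != 1 -> push a p u =
  if E u v then p u else (if u == v then Some (Tagged G a) else None) :: p u.
Proof. by rewrite /push; case: eqP. Qed.

Lemma unblocked_push u v (b : G v) p :
  E u v -> unblocked u (push b p) = unblocked u p.
Proof. by move=> uv; rewrite /unblocked /push; case: eqP; rewrite ?uv. Qed.

Lemma top_push u v (b : G v) p : E u v -> top u (push b p) = top u p.
Proof. by move=> uv; rewrite /top /push; case: eqP; rewrite ?uv. Qed.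

Lemma push_blocked v (a : G v) p : a != 1 -> unblocked v (push a p) = false.
Proof. by move=> a1; rewrite /unblocked pushE// E_irr eqxx. Qed.

Lemma top_dependent u v (b : G v) p :
  b != 1 -> u != v -> ~~ E u v -> top u (push b p) = 1.
Proof. by move=> b1 uv nuv; rewrite /top pushE// (negPf nuv) (negPf uv). Qed.

Lemma top_unblocked v p : unblocked v p -> top v p = 1.
Proof. by rewrite /unblocked /top; case: (p v) => [|[]]. Qed.

Lemma pop_unblocked v p : unblocked v p -> pop v p = p.
Proof. by rewrite /pop => ->. Qed.

Lemma top_pushK v (a : G v) p : unblocked v p -> top v (push a p) = a.
Proof.
have [->|a1] := eqVneq a 1; first by rewrite push1; exact: top_unblocked.
by move=> _; rewrite /top pushE// E_irr eqxx tagged_asE.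
Qed.

Lemma pop_pushK v (a : G v) p : unblocked v p -> pop v (push a p) = p.
Proof.
have [->|a1] := eqVneq a 1; first by rewrite push1; exact: pop_unblocked.
move=> _; rewrite /pop push_blocked//=; apply/funext => u.
by rewrite pushE//; case: (E u v).
Qed.

Lemma pushC u v (a : G u) (b : G v) p :
  E u v -> push a (push b p) = push b (push a p).
Proof.
move=> uv; have [->|a1] := eqVneq a 1; first by rewrite !push1.
have [->|b1] := eqVneq b 1; first by rewrite !push1.
apply/funext => t; rewrite !pushE//.
have [tu|tu] := boolP (E t u); have [tv|tv] := boolP (E t v) => //.
have [tu'|] := eqVneq t u; first by rewrite tu' uv in tv.
have [tv'|//] := eqVneq t v; by rewrite tv' E_sym uv in tu.
Qed.

(** The syllable visible on stack v can be moved below the syllables pushed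
    after it, as these are at vertices adjacent to v.  So every valid pile is
    a push onto a pile with no syllable available at v, and on such
    expressions the action is just multiplication in G_v. *)
Lemma push_pop v p : valid p ->
  [/\ push (top v p) (pop v p) = p, valid (pop v p) & unblocked v (pop v p)].
Proof.
elim=> [|u c q vq [IH1 IH2 IH3] uq].
  by rewrite pop_unblocked// top_unblocked// push1; split=> //; constructor.
have [uv|nuv] := eqVneq v u.
  by case: _ / uv c uq => c uq; rewrite top_pushK// pop_pushK.
have [c1|c1] := eqVneq c 1; first by rewrite c1 push1.
have [vu|nvu] := boolP (E v u); last first.
  have f : unblocked v (push c q).
    by rewrite /unblocked pushE// (negPf nvu) (negPf nuv).
  rewrite top_unblocked// pop_unblocked// push1; split=> //.
  exact: valid_push.
have uv : E u v by rewrite E_sym.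
have fu : unblocked u (pop v q) by rewrite -IH1 unblocked_push in uq.
have fv : unblocked v (push c (pop v q)) by rewrite unblocked_push.
have e : push c q = push (top v q) (push c (pop v q)) by rewrite pushC// IH1.
by rewrite e top_pushK// pop_pushK//; split=> //; apply: valid_push.
Qed.

Lemma act_push v (a b : G v) p :
  unblocked v p -> act a (push b p) = push (a * b) p.
Proof. by move=> f; rewrite /act top_pushK// pop_pushK. Qed.

Lemma act_unblocked v (a : G v) p : unblocked v p -> act a p = push a p.
Proof. by move=> f; rewrite -{1}[p](push1 v) act_push// mulg1. Qed.

Lemma valid_act v (a : G v) p : valid p -> valid (act a p).
Proof. by case/(push_pop v) => e vp f; rewrite -e act_push//; constructor. Qed.

Lemma act1 v p : valid p -> act (1 : G v) p = p.
Proof. by case/(push_pop v) => e vp f; rewrite -e act_push// mul1g. Qed.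

Lemma actM v (a b : G v) p : valid p -> act a (act b p) = act (a * b) p.
Proof. by case/(push_pop v) => e vp f; rewrite -e !act_push// mulgA. Qed.

Lemma actC u v (a : G u) (b : G v) p :
  E u v -> valid p -> act a (act b p) = act b (act a p).
Proof.
move=> uv vp; have vu : E v u by rewrite E_sym.
have [e vq fq] := push_pop v vp.
have [e' vq' fq'] := push_pop u vq.
move: e e' fq' fq; set c := top v p; set d := top u _; set q := pop u _.
move=> e e' fuq; rewrite -e' unblocked_push// => fvq; rewrite -e -e'.
have fX (x : G u) : unblocked v (push x q) by rewrite unblocked_push.
have fY (y : G v) : unblocked u (push y q) by rewrite unblocked_push.
rewrite (act_push b c (fX d)) -!(pushC d _ q uv) !(act_push a d (fY _)).
by rewrite !(pushC _ _ q uv) act_push.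
Qed.

(** * The action of the graph product *)

Definition act_word w p : pile :=
  foldr (fun s => @act (tag s) (tagged s)) p w.

Lemma act_word_cat w1 w2 p :
  act_word (w1 ++ w2) p = act_word w1 (act_word w2 p).
Proof. by rewrite /act_word foldr_cat. Qed.

Lemma valid_act_word w p : valid p -> valid (act_word w p).
Proof. by move=> vp; elim: w => //= s w IH; apply: valid_act. Qed.

Lemma act_word_cong w w' :
  word_cong w w' -> forall p, valid p -> act_word w p = act_word w' p.
Proof.
elim=> {w w'} //=.
- by move=> w1 w2 _ IH p vp; rewrite IH.
- by move=> w1 w2 w3 _ IH _ IH' p vp; rewrite IH// IH'.
- move=> w1 w2 w1' w2' _ IH _ IH' p vp.
  by rewrite !act_word_cat IH'// IH//; apply: valid_act_word.
- by move=> v p; apply: act1.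
- by move=> v a b p; apply: actM.
Qed.

Definition acts_trivially (x : free_product G) : Prop :=
  forall w, fp_class w = x -> forall p, valid p -> act_word w p = p.

Lemma acts_triviallyE w : acts_trivially (fp_class w) <->
  forall p, valid p -> act_word w p = p.
Proof.
split=> [h|h w' /fp_classP e p vp]; first exact: h.
by rewrite (act_word_cong e)// h.
Qed.

Lemma act_wordVK w p : valid p -> act_word (word_inv w) (act_word w p) = p.
Proof.
by move=> vp; rewrite -act_word_cat (act_word_cong (word_mulV w)).
Qed.

Lemma act_wordKV w p : valid p -> act_word w (act_word (word_inv w) p) = p.
Proof. by move=> vp; rewrite -{1}[w]word_invK act_wordVK. Qed.

Lemma fp_class_surj (x : free_product G) : exists w, x = fp_class w.
Proof. by exists (repr x); rewrite fp_reprK. Qed.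

Lemma mul_fp_class w w' :
  (fp_class w : free_product G) * fp_class w' = fp_class (w ++ w').
Proof. exact/esym/fp_classM. Qed.

Lemma inv_fp_class w : (fp_class w : free_product G)^-1 = fp_class (word_inv w).
Proof. exact/esym/fp_classV. Qed.

Lemma acts_trivially_normal : normal_subgroup acts_trivially.
Proof.
split; first split.
- by apply/acts_triviallyE.
- move=> x y; have [wx ->] := fp_class_surj x; have [wy ->] := fp_class_surj y.
  move=> /set_mem/acts_triviallyE hx /set_mem/acts_triviallyE hy.
  rewrite mul_fp_class; apply/acts_triviallyE => p vp.
  by rewrite act_word_cat hy// hx.
- move=> x; have [wx ->] := fp_class_surj x.
  move=> /set_mem/acts_triviallyE hx.
  rewrite inv_fp_class; apply/acts_triviallyE => p vp.
  by rewrite -{1}(hx p vp) act_wordVK.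
- move=> x y; have [wx ->] := fp_class_surj x; have [wy ->] := fp_class_surj y.
  move=> /acts_triviallyE hx.
  rewrite conjgE inv_fp_class (mul_fp_class wx) mul_fp_class.
  apply/acts_triviallyE => p vp.
  by rewrite !act_word_cat hx ?act_wordVK//; apply: valid_act_word.
Qed.

Lemma word_prodE w : word_prod E w = quotient_proj _ (fp_class w).
Proof.
elim: w => [|[v a] w IH]; first by rewrite /word_prod big_nil.
rewrite /word_prod big_cons -/(word_prod _ w) IH.
by rewrite -[existT _ v a :: w]cat1s fp_classM quotient_projM.
Qed.

(** The normal closure of the commutators lies in the kernel of the action
    on valid piles, so this action is one of the graph product. *)
Lemma act_word_prod w w' p :
  word_prod E w = word_prod E w' -> valid p -> act_word w p = act_word w' p.
Proof.
rewrite !word_prodE => /quotient_projP h vp.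
have {h} : acts_trivially ((fp_class w)^-1 * fp_class w').
  apply: h; split; first exact: acts_trivially_normal.
  move=> _ [v1 [v2 [g1 [g2 [e ->]]]]].
  rewrite /commg conjgE /fp_incl !inv_fp_class.
  rewrite (mul_fp_class [:: Tagged G g1]).
  rewrite (mul_fp_class (word_inv [:: Tagged G g2])) mul_fp_class.
  apply/acts_triviallyE => q vq /=.
  rewrite (actC (g1 : G v1) g2)//.
  rewrite (actM g2^-1); last exact: valid_act.
  rewrite mulVg act1; last exact: valid_act.
  by rewrite actM// mulVg act1.
rewrite inv_fp_class mul_fp_class => /acts_triviallyE/(_ _ vp).
rewrite act_word_cat => h.
by rewrite -[in LHS]h act_wordKV//; exact: valid_act_word.
Qed.

(** * Irreducible words *)

(** Some syllable at v can be shuffled to the front of a word with vertex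
    sequence t. *)
Definition starts v (t : seq V) : bool :=
  ohead [seq u <- t | ~~ E v u] == Some v.

Fixpoint merge_free (t : seq V) : bool :=
  if t is v :: t' then ~~ starts v t' && merge_free t' else true.

Definition irreducible w : bool :=
  merge_free (map tag w) && all (fun s => tagged s != 1) w.

(** If the syllables of w are nontrivial, this is the result of pushing them in
    turn onto the empty pile, starting from the last one. *)
Definition pile_of w : pile := fun v =>
  [seq if tag s == v then Some s else None | s <- w & ~~ E v (tag s)].

Lemma starts_cons v u t :
  starts v (u :: t) = if E v u then starts v t else u == v.
Proof. by rewrite /starts /=; case: (E v u). Qed.

Lemma starts_adjacent_cat v t1 t2 :
  all (E v) t1 -> starts v (t1 ++ t2) = starts v t2.
Proof. by elim: t1 => //= u t IH /andP[uv /IH]; rewrite starts_cons uv. Qed.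

Lemma starts_catl v t1 t2 :
  ~~ all (E v) t1 -> starts v (t1 ++ t2) = starts v t1.
Proof.
elim: t1 => //= u t IH; rewrite !starts_cons.
by case: (E v u) => //=; apply: IH.
Qed.

Lemma starts_mem v t : starts v t -> v \in t.
Proof.
elim: t => //= u t IH; rewrite starts_cons inE.
case: ifP => [_ /IH ->|_ /eqP ->]; by rewrite ?orbT ?eqxx.
Qed.

Lemma starts_swap v u1 u2 t :
  E u1 u2 -> starts v [:: u1, u2 & t] = starts v [:: u2, u1 & t].
Proof.
move=> e; rewrite !starts_cons.
have [e1|e1] := boolP (E v u1); have [e2|e2] := boolP (E v u2) => //.
have [u1v|_] := eqVneq u1 v; first by rewrite -u1v e in e2.
have [u2v|//] := eqVneq u2 v; by rewrite -u2v E_sym e in e1.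
Qed.

Lemma starts_move v u t1 t2 :
  all (E u) t1 -> starts v (t1 ++ u :: t2) = starts v (u :: t1 ++ t2).
Proof.
elim: t1 => //= u' t IH /andP[e /IH IH']; rewrite (starts_swap _ _ e).
by rewrite starts_cons IH' [RHS]starts_cons.
Qed.

Lemma merge_free_move u t1 t2 :
  all (E u) t1 -> merge_free (t1 ++ u :: t2) = merge_free (u :: t1 ++ t2).
Proof.
elim: t1 => //= u' t IH /andP[e ea]; rewrite starts_move// IH//=.
by rewrite !starts_cons e (E_sym u') e andbCA.
Qed.

Lemma starts_rev_cons v u t : starts v (rev (u :: t)) =
  if all (E v) t then u == v else starts v (rev t).
Proof.
rewrite rev_cons -cats1; case: ifPn => h.
  rewrite starts_adjacent_cat ?all_rev// starts_cons.
  by have [->|uv] := eqVneq u v; rewrite ?E_irr //; case: (E v u).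
by rewrite starts_catl// all_rev.
Qed.

(** A merge across a concatenation takes place between the last syllable of
    the left factor and the first one of the right factor that do not commute
    with the vertex concerned. *)
Lemma merge_free_cat t1 t2 : merge_free (t1 ++ t2) =
  [&& merge_free t1, merge_free t2 &
      [forall v, ~~ (starts v (rev t1) && starts v t2)]].
Proof.
elim: t1 => /= [|u t ->].
  by rewrite (_ : [forall v, _]) ?andbT//; apply/forallP.
have [ut|nut] := boolP (all (E u) t).
  rewrite starts_adjacent_cat// (_ : starts u t = false); last first.
    apply: contraTF ut => /starts_mem ut; apply/allPn.
    by exists u; rewrite ?E_irr.
  rewrite /= andbCA; congr (_ && _); rewrite andbCA; congr (_ && _).
  apply/andP/forallP => [[nu /forallP h] v|h].
    rewrite starts_rev_cons; case: ifP => // _.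
    by have [<-|//] := eqVneq u v; rewrite nu.
  have := h u; rewrite starts_rev_cons ut eqxx => nu; split=> //.
  apply/forallP => v; have := h v; rewrite starts_rev_cons.
  case: ifPn => // hv _; rewrite negb_and; apply/orP; left.
  by apply/negP => /starts_mem; rewrite mem_rev => /(allP hv); rewrite E_irr.
rewrite starts_catl// -!andbA; congr [&& _, _, _ & _].
apply/forallP/forallP => h v; have := h v; rewrite starts_rev_cons.
  case: ifPn => // hv; have [uv|//] := eqVneq u v.
  by rewrite uv hv in nut.
case: ifPn => // hv _; rewrite negb_and; apply/orP; left.
by apply/negP => /starts_mem; rewrite mem_rev => /(allP hv); rewrite E_irr.
Qed.

Lemma merge_free_rev t : merge_free (rev t) = merge_free t.
Proof.
elim: t => //= u t IH; rewrite rev_cons -cats1 merge_free_cat IH revK andbC.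
rewrite /=; congr (_ && _); apply/forallP/idP => [/(_ u)|h v].
  by rewrite starts_cons E_irr eqxx andbT.
rewrite starts_cons; case: ifP => _; first by rewrite /starts andbF.
by have [<-|_] := eqVneq u v; rewrite ?andbT ?andbF.
Qed.

Lemma irreducible_catl w1 w2 : irreducible (w1 ++ w2) -> irreducible w1.
Proof.
rewrite /irreducible map_cat merge_free_cat all_cat.
by case/andP => /and3P[-> _ _] /andP[].
Qed.

Lemma irreducible_catr w1 w2 : irreducible (w1 ++ w2) -> irreducible w2.
Proof.
rewrite /irreducible map_cat merge_free_cat all_cat.
by case/andP => /and3P[_ -> _] /andP[].
Qed.

Lemma unblocked_pile_of v w :
  unblocked v (pile_of w) = ~~ starts v (map tag w).
Proof.
rewrite /unblocked /pile_of /starts.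
elim: w => //= s w IH; case: (boolP (E v (tag s))) => //= _.
by case: eqVneq => [->|]; rewrite ?eqxx//; case: eqP => // -[->]; rewrite eqxx.
Qed.

Lemma pile_of_cons v (a : G v) w :
  a != 1 -> pile_of (Tagged G a :: w) = push a (pile_of w).
Proof.
move=> a1; apply/funext => u; rewrite pushE// /pile_of /=.
by case: (E u v) => //=; rewrite eq_sym.
Qed.

Lemma irreducible_cons v (a : G v) w : irreducible (Tagged G a :: w) =
  [&& a != 1, unblocked v (pile_of w) & irreducible w].
Proof.
by rewrite unblocked_pile_of /irreducible /= andbCA -andbA.
Qed.

Lemma act_word_nil w : irreducible w -> act_word w (fun=> [::]) = pile_of w.
Proof.
elim: w => [//|[v a] w IH].
rewrite irreducible_cons => /and3P[a1 f /IH /= ->].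
by rewrite pile_of_cons// act_unblocked.
Qed.

(** Irreducible words are normal forms up to shuffling: the pile is a function
    of the group element. *)
Lemma irreducible_pile_eq w w' : irreducible w -> irreducible w' ->
  word_prod E w = word_prod E w' -> pile_of w = pile_of w'.
Proof.
move=> iw iw' e; rewrite -act_word_nil// -act_word_nil//.
by apply: act_word_prod => //; apply: valid_nil.
Qed.

Lemma word_prod_cat w1 w2 :
  word_prod E (w1 ++ w2) = word_prod E w1 * word_prod E w2.
Proof. by rewrite /word_prod big_cat. Qed.

Lemma word_prod_cons v (a : G v) w :
  word_prod E (Tagged G a :: w) = gp_incl E a * word_prod E w.
Proof. by rewrite /word_prod big_cons. Qed.

Lemma word_prod_nil : word_prod E ([::] : word G) = 1.
Proof. by rewrite /word_prod big_nil. Qed.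

Lemma gp_inclC u v (a : G u) (b : G v) :
  E u v -> commute (gp_incl E a) (gp_incl E b).
Proof.
move=> e; rewrite /commute /gp_incl.
have projM (x y : free_product G) :
    quotient_proj (edge_commutators E (G:=G)) x * quotient_proj _ y =
    quotient_proj _ (x * y) by rewrite [RHS]quotient_projM.
rewrite (projM (fp_incl a)) (projM (fp_incl b)).
apply/quotient_projP => N [nN sub]; apply: sub.
exists v, u, b, a; split; first by rewrite E_sym.
by rewrite invgM /commg conjgE !mulgA.
Qed.

Lemma gp_inclV v (a : G v) : gp_incl E a^-1 = (gp_incl E a)^-1.
Proof. by apply: (mulgI (gp_incl E a)); rewrite -gp_inclM !mulgV gp_incl1. Qed.

Lemma word_prod_inv w : word_prod E (word_inv w) = (word_prod E w)^-1.
Proof.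
elim: w => [|[v a] w IH]; first by rewrite word_prod_nil invg1.
rewrite /word_inv /= rev_cons -cats1 word_prod_cat -/(word_inv w) IH.
by rewrite !word_prod_cons word_prod_nil mulg1 invgM gp_inclV.
Qed.

Lemma irreducible_inv w : irreducible (word_inv w) = irreducible w.
Proof.
rewrite /irreducible /word_inv map_rev merge_free_rev -map_comp all_rev all_map.
congr (_ && _); apply: eq_all => s /=; by rewrite invg_eq1.
Qed.

Lemma pile_of_move v (a : G v) w1 w2 : all (fun s => E v (tag s)) w1 ->
  pile_of (w1 ++ Tagged G a :: w2) = pile_of (Tagged G a :: w1 ++ w2).
Proof.
elim: w1 => //= s w IH /andP[e /IH IH']; apply/funext => u.
have /(congr1 (@^~ u)) := IH'; rewrite /pile_of /= => IHu.
have [us|us] /= := boolP (E u (tag s)); rewrite IHu; first by rewrite ?us.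
have [uv|uv] /= := boolP (E u v) => //.
have [vu|_] := eqVneq v u; first by rewrite -vu e in us.
by have [su|//] := eqVneq (tag s) u; rewrite -su E_sym e in uv.
Qed.

Lemma word_prod_move v (a : G v) w1 w2 : all (fun s => E v (tag s)) w1 ->
  word_prod E (w1 ++ Tagged G a :: w2) = word_prod E (Tagged G a :: w1 ++ w2).
Proof.
elim: w1 => //= -[u b] w IH /andP[/= e /IH IH'].
by rewrite !word_prod_cons IH' word_prod_cons !mulgA (gp_inclC a b).
Qed.

Lemma irreducible_move v (a : G v) w1 w2 : all (fun s => E v (tag s)) w1 ->
  irreducible (w1 ++ Tagged G a :: w2) = irreducible (Tagged G a :: w1 ++ w2).
Proof.
move=> e; rewrite /irreducible map_cat merge_free_move ?all_map//=.
by rewrite map_cat; congr (_ && _); rewrite !all_cat /= andbCA.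
Qed.

Lemma starts_split v w : starts v (map tag w) -> exists w1 (a : G v) w2,
  w = w1 ++ Tagged G a :: w2 /\ all (fun s => E v (tag s)) w1.
Proof.
elim: w => //= -[u b] w IH; rewrite starts_cons /=; case: ifP => [e|_].
  move=> /IH[w1 [a [w2 [-> h]]]].
  by exists (Tagged G b :: w1), a, w2; split=> //=; rewrite e.
by move/eqP => uv; case: _ / uv; exists [::], b, w.
Qed.

(** The initial syllable at v, if any, can be split off a word.  When there is
    none the lemma holds with w' = w, which spares case distinctions. *)
Lemma peel v w : irreducible w -> exists w',
  [/\ irreducible w', unblocked v (pile_of w'),
      pile_of w = push (top v (pile_of w)) (pile_of w'),
      word_prod E w = gp_incl E (top v (pile_of w)) * word_prod E w' &
      size w = ((top v (pile_of w) != 1%g) + size w')%N].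
Proof.
move=> iw; have [f|] := boolP (unblocked v (pile_of w)).
  exists w; rewrite top_unblocked// push1 gp_incl1 mul1g eqxx.
  by split.
rewrite unblocked_pile_of negbK => /starts_split[w1 [a [w2 [we h]]]].
move: iw; rewrite we pile_of_move// irreducible_move// irreducible_cons.
move=> /and3P[a1 f iw]; exists (w1 ++ w2).
rewrite pile_of_cons// top_pushK// word_prod_move// word_prod_cons a1.
by split=> //; rewrite !size_cat addnS.
Qed.

Lemma mul_irreducible s w : irreducible w -> irreducible (s :: w) \/
  exists w', [/\ irreducible w', word_prod E w' = word_prod E (s :: w) &
                 (size w' <= size w)%N].
Proof.
case: s => v a iw.
have [a1|a1] := eqVneq a 1.
  by right; exists w; rewrite a1 word_prod_cons gp_incl1 mul1g.
have [w' [iw' f pe we se]] := peel v iw.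
move: pe we se; set b := top v _ => pe we se.
have [b1|b1] := eqVneq b 1.
  by left; rewrite irreducible_cons a1 iw pe b1 push1 f.
right; have [ab|ab] := eqVneq (a * b) 1.
  exists w'; rewrite word_prod_cons we mulgA -gp_inclM ab gp_incl1 mul1g.
  by split=> //; rewrite se leq_addl.
exists (Tagged G (a * b) :: w').
rewrite irreducible_cons ab f iw' !word_prod_cons we mulgA gp_inclM.
by split=> //; rewrite se b1.
Qed.

(** Read from the right, every syllable that cannot be prepended merges or
    cancels with an initial one, which loses at least one syllable; so words
    of minimal length are irreducible. *)
Lemma irreducible_shorten w : irreducible w \/
  exists w', [/\ irreducible w', word_prod E w' = word_prod E w &
                 (size w' < size w)%N].
Proof.
elim: w => [|s w [iw|[w' [iw' pe sl]]]]; first by left.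
  have [|[w' [? ? ?]]] := mul_irreducible s iw; first by left.
  by right; exists w'.
have e : word_prod E (s :: w') = word_prod E (s :: w).
  by case: s => v a; rewrite !word_prod_cons pe.
right; have [isw|[w'' [iw'' pe' sl']]] := mul_irreducible s iw'.
  by exists (s :: w').
exists w''; split=> //; first by rewrite pe'.
by apply: leq_ltn_trans sl' _; apply: ltnW.
Qed.

Lemma count_pile_of v w :
  count_mem v (map tag w) = count isSome (pile_of w v).
Proof.
rewrite /pile_of count_map count_map count_filter; apply: eq_count => s /=.
by case: eqVneq => [->|]; rewrite ?E_irr.
Qed.

(** Once the pile is known, a prefix is determined by the number of its
    syllables at each vertex, because the syllables at one vertex occur in the
    same order in all reduced words of an element. *)
Lemma prefix_unique w1 w2 w1' w2' :
  irreducible (w1 ++ w2) -> irreducible (w1' ++ w2') ->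
  pile_of (w1 ++ w2) = pile_of (w1' ++ w2') ->
  (forall v, count_mem v (map tag w1) = count_mem v (map tag w1')) ->
  perm_eq w1 w1' /\ word_prod E w1 = word_prod E w1'.
Proof.
elim: w1 w1' => [|[v a] w1 IH] w1'.
  case: w1' => [//|s w1'] _ _ _ /(_ (tag s)) /=.
  by rewrite eqxx.
rewrite cat_cons irreducible_cons => /and3P[a1 f iw] iw' pe ce.
have vw' : v \in map tag w1'.
  by rewrite -has_pred1 has_count -ce /= eqxx.
have : starts v (map tag w1').
  rewrite -(starts_catl (map tag w2')); last first.
    by apply/allPn; exists v; rewrite ?E_irr.
  rewrite -map_cat -[starts _ _]negbK -unblocked_pile_of -pe pile_of_cons//.
  by rewrite push_blocked.
move=> /starts_split[q1 [b [q2 [we h]]]].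
move: iw' pe ce; rewrite {}we -catA cat_cons irreducible_move// pile_of_move//.
rewrite irreducible_cons => /and3P[b1 f' iw'].
rewrite !pile_of_cons// => pe ce.
(* The pile shows the initial syllable at v, so both words have the same one
   and it can be cancelled. *)
have ab : a = b by rewrite -(top_pushK a f) pe top_pushK.
have pe' : pile_of (w1 ++ w2) = pile_of ((q1 ++ q2) ++ w2').
  by rewrite -(pop_pushK a f) pe pop_pushK// catA.
have [||pw ww] := IH _ iw _ pe'; first by rewrite -catA.
  move=> u; have := ce u; rewrite /= !map_cat !count_cat /=.
  by rewrite addnCA => /addnI.
split; last by rewrite word_prod_move// !word_prod_cons ww ab.
by rewrite -ab -cat1s perm_sym -[_ :: q2]cat1s perm_catCA perm_cat2l perm_sym.
Qed.

Lemma irreducible_unique w w' : irreducible w -> irreducible w' ->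
  word_prod E w = word_prod E w' -> perm_eq w w'.
Proof.
move=> iw iw' e; have pe := irreducible_pile_eq iw iw' e.
have := @prefix_unique w [::] w' [::]; rewrite !cats0.
by case=> // v; rewrite !count_pile_of pe.
Qed.

(** * Reduced representations *)

Lemma irreducible_represents w :
  irreducible w -> represents w (word_prod E w).
Proof.
move=> iw; split=> //; elim: w iw => // -[v a] w IH.
rewrite irreducible_cons => /and3P[_ f /IH].
case: w f {IH} => //= -[u b] w f ->; rewrite andbT /=.
apply: contraTneq f => /= vu.
by rewrite unblocked_pile_of /= starts_cons -vu E_irr eqxx.
Qed.

Lemma reduced_irreducible w g : reduced (E := E) w g -> irreducible w.
Proof.
case=> -[_ we] se; have [//|[w' [iw' pe]]] := irreducible_shorten w.
rewrite se /syllable_length; case: ex_minnP => m _ /(_ (size w')) min.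
rewrite ltnNge min//; apply/asboolP; exists w'; split=> //.
by rewrite -we -pe; apply: irreducible_represents.
Qed.

Lemma irreducible_reduced_word w :
  irreducible w -> perm_eq (reduced_word (word_prod E w)) w.
Proof.
move=> iw; rewrite /reduced_word; case: cid => w' /= rw'.
have iw' := reduced_irreducible rw'.
by apply: irreducible_unique => //; case: rw' => -[].
Qed.

Lemma irreducible_exists (g : graph_product E G) :
  exists2 w, irreducible w & word_prod E w = g.
Proof.
have [w rw] := reduced_exists g.
by exists w; [exact: reduced_irreducible rw|case: rw => -[]].
Qed.

(** * The triangle decomposition *)

Lemma blocked_top v w : irreducible w ->
  (top v (pile_of w) != 1) = starts v (map tag w).
Proof.
move=> iw; rewrite -[RHS]negbK -unblocked_pile_of.
have [w' [_ f pe _ _]] := peel v iw; apply/idP/idP => [t1|].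
  by rewrite pe push_blocked.
by apply: contra => /eqP t1; rewrite pe t1 push1.
Qed.

Lemma pile_of_cat w w1 w2 : pile_of w1 = pile_of w2 ->
  pile_of (w ++ w1) = pile_of (w ++ w2).
Proof.
move=> e; apply/funext => v; rewrite /pile_of !filter_cat !map_cat.
by congr (_ ++ _); apply: (congr1 (@^~ v) e).
Qed.

Lemma irreducible_replace w w1 w2 : irreducible (w ++ w1) -> irreducible w2 ->
  word_prod E w1 = word_prod E w2 -> irreducible (w ++ w2).
Proof.
move=> iw1 iw2 e; have iw := irreducible_catr iw1.
have pe := irreducible_pile_eq iw iw2 e.
elim: w iw1 => //= -[v a] w IH.
rewrite !irreducible_cons => /and3P[-> f /IH ->].
by rewrite -(pile_of_cat w pe) f.
Qed.

(** Splitting off equal initial syllables as long as there are any yields a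
    common prefix after which the two words share no initial syllable. *)
Lemma common_prefix w1 w2 : irreducible w1 -> irreducible w2 ->
  exists a r1 r2,
    [/\ irreducible (a ++ r1) /\ word_prod E (a ++ r1) = word_prod E w1,
        irreducible (a ++ r2) /\ word_prod E (a ++ r2) = word_prod E w2 &
        forall v, top v (pile_of r1) = top v (pile_of r2) ->
                  top v (pile_of r1) = 1].
Proof.
have [n] := ubnP (size w1); elim: n w1 w2 => // n IH w1 w2 sn iw1 iw2.
have [[v [te t1]]|no] := pselect (exists v,
    top v (pile_of w1) = top v (pile_of w2) /\ top v (pile_of w1) != 1).
  have [w1' [iw1' f1 pe1 we1 se1]] := peel v iw1.
  have [w2' [iw2' f2 pe2 we2 _]] := peel v iw2.
  have [|a [r1 [r2 [[i1 e1] [i2 e2] h]]]] := IH w1' w2' _ iw1' iw2'.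
    by move: sn; rewrite se1 t1.
  exists (Tagged G (top v (pile_of w1)) :: a), r1, r2; split=> //.
    rewrite cat_cons irreducible_cons t1 i1 word_prod_cons e1.
    by rewrite (irreducible_pile_eq i1 iw1' e1) f1.
  rewrite cat_cons irreducible_cons t1 i2 word_prod_cons e2.
  by rewrite (irreducible_pile_eq i2 iw2' e2) f2 we2 te.
exists [::], w1, w2; split=> // v te.
by apply/eqP; apply/negPn/negP => t1; apply: no; exists v.
Qed.

Definition letters (T : seq V) (x : forall v, G v) : word G :=
  [seq Tagged G (x v) | v <- T].

Lemma tag_letters T x : map tag (letters T x) = T.
Proof. by rewrite /letters -map_comp map_id. Qed.

(** Two initial syllables commute: if u and v were not adjacent, a syllable at
    v would hide any syllable at u that comes after it. *)
Lemma top_adjacent u v w : irreducible w -> u != v ->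
  top u (pile_of w) != 1 -> top v (pile_of w) != 1 -> E u v.
Proof.
move=> iw uv + tv; apply: contraNT => nuv.
by have [w' [_ _ -> _ _]] := peel v iw; rewrite top_dependent.
Qed.

(** Initial syllables at different vertices are adjacent, so splitting off one
    of them leaves the other ones initial with the same values. *)
Lemma peel_letters T w : irreducible w -> uniq T ->
  {in T, forall v, top v (pile_of w) != 1} ->
  exists w', irreducible (letters T (fun v => top v (pile_of w)) ++ w') /\
    word_prod E (letters T (fun v => top v (pile_of w)) ++ w') = word_prod E w.
Proof.
elim: T w => [|v T IH] w iw /=; first by exists w.
case/andP => vT uT tT.
have tv : top v (pile_of w) != 1 by apply: tT; rewrite mem_head.
have [w1 [iw1 f pe we _]] := peel v iw.
have tE : {in T, forall u, top u (pile_of w1) = top u (pile_of w)}.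
  move=> u uT'; rewrite pe top_push//; apply: (top_adjacent iw) tv.
    by apply: contraNneq vT => <-.
  by apply: tT; rewrite inE uT' orbT.
have [u uT'|w' [iw' we']] := IH w1 iw1 uT.
  by rewrite tE//; apply: tT; rewrite inE uT' orbT.
have lE : letters T (fun u => top u (pile_of w1)) =
          letters T (fun u => top u (pile_of w)).
  by apply/eq_in_map => u uT'; rewrite tE.
exists w'; rewrite irreducible_cons tv word_prod_cons -lE iw' we' -we.
by rewrite (irreducible_pile_eq iw' iw1 we') f.
Qed.

Lemma word_prod_letters_div T (x y : forall v, G v) :
  uniq T -> {in T &, forall u v, u != v -> E u v} ->
  word_prod E (letters T (fun v => (x v)^-1 * y v)) =
  (word_prod E (letters T x))^-1 * word_prod E (letters T y).
Proof.
elim: T => [_ _|v T IH /= /andP[vT uT] cT].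
  by rewrite word_prod_nil mulg1 invg1.
rewrite !word_prod_cons {}IH//; last first.
  by move=> u u' uT' uT'' ; apply: cT; rewrite inE (uT', uT'') orbT.
set a := (x v)^-1 * y v.
have c : gp_incl E a * word_prod E (letters T x) =
         word_prod E (letters T x) * gp_incl E a.
  have := @word_prod_move v a (letters T x) [::].
  rewrite word_prod_cat !word_prod_cons word_prod_nil mulg1 cats0 => -> //.
  rewrite all_map; apply/allP => u uT' /=.
  apply: cT; rewrite ?mem_head ?inE ?uT' ?orbT//.
  by apply: contraNneq vT => ->.
have -> : gp_incl E (y v) = gp_incl E (x v) * gp_incl E a.
  by rewrite -gp_inclM mulVKg.
rewrite invgM !mulgA; congr (_ * _); rewrite mulgVK.
apply: (mulgI (word_prod E (letters T x))).
by rewrite !mulgA -c mulgK mulgV mul1g.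
Qed.

Lemma starts_clique v t :
  v \in t -> {in t, forall u, u != v -> E v u} -> starts v t.
Proof.
elim: t => //= u t IH; rewrite inE starts_cons => vt h.
case: ifPn => [vu|nvu]; last first.
  by apply: contraNT nvu => uv; apply: h => //; rewrite mem_head.
apply: IH => [|u' ut uv]; last by apply: h => //; rewrite inE ut orbT.
by case/orP: vt => // /eqP vu'; rewrite vu' E_irr in vu.
Qed.

(** By [merge_free_cat] a merge in this word would take place between b and
    z c, at some vertex v.  If v is not adjacent to all of C, then the first
    syllable of z c that does not commute with v is in z, and being at v it
    puts v in C; if v is adjacent to all of C, then b and c start at v and the
    last hypothesis puts v in C.  But for v in C the word
    x b would not be irreducible. *)
Lemma irreducible_triangle (C : {set V}) x y b c :
  clique E C ->
  irreducible (letters (enum C) x ++ b) ->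
  irreducible (letters (enum C) y ++ c) ->
  (forall v, v \in C -> x v != y v) ->
  (forall v, starts v (enum C ++ map tag b) ->
             starts v (enum C ++ map tag c) -> v \in C) ->
  irreducible (word_inv b ++ letters (enum C) (fun v => (x v)^-1 * y v) ++ c).
Proof.
move=> cC ixb iyc xy h.
have ib : irreducible (word_inv b).
  by rewrite irreducible_inv; apply: irreducible_catr ixb.
move: ixb iyc ib; rewrite /irreducible !map_cat !all_cat !tag_letters.
case/andP => + _ /andP[mc] /andP[_ ac] /andP[mb ab].
rewrite merge_free_cat => /and3P[_ _ /forallP mx].
rewrite merge_free_cat mb mc ab ac andbT/=; apply/andP; split; last first.
  apply/allP => s /mapP[v]; rewrite mem_enum => /xy vxy -> /=.
  by rewrite -(inj_eq (mulgI (x v))) mulVKg mulg1 eq_sym.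
apply/forallP => v; apply/negP; rewrite /word_inv map_rev revK -map_comp.
case/andP => sb sc.
have clC u : u \in C -> v \in C -> u != v -> E v u.
  move=> uC vC uv; move/forall_inP : cC => /(_ v vC)/forall_inP/(_ u uC).
  by rewrite eq_sym uv.
have vC : v \in C.
  have [aC|naC] := boolP (all (E v) (enum C)).
    by apply: h; rewrite starts_adjacent_cat// -(starts_adjacent_cat _ aC).
  rewrite -mem_enum; apply: starts_mem.
  by rewrite -(starts_catl (map tag c) naC).
(* The vertices of C are pairwise adjacent, so v is also accessible from the
   end of the C-part of x b. *)
have := mx v; rewrite (_ : starts v _) ?sb//.
apply: starts_clique; rewrite ?mem_rev ?mem_enum// => u.
by rewrite mem_rev mem_enum => uC; apply: clC.
Qed.

Lemma centroid_decomposition (g k : graph_product E G) :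
  exists (C : {set V}) (x y : forall v, G v) (a b c : word G),
  [/\ clique E C,
      irreducible (a ++ letters (enum C) x ++ b) /\
        word_prod E (a ++ letters (enum C) x ++ b) = g,
      irreducible (a ++ letters (enum C) y ++ c) /\
        word_prod E (a ++ letters (enum C) y ++ c) = k,
      irreducible
        (word_inv b ++ letters (enum C) (fun v => (x v)^-1 * y v) ++ c) &
      word_prod E (letters (enum C) (fun v => (x v)^-1 * y v)) =
        (word_prod E (letters (enum C) x))^-1 *
          word_prod E (letters (enum C) y)].
Proof.
have [wg iwg <-] := irreducible_exists g.
have [wk iwk <-] := irreducible_exists k.
have [a [ug [uk [[iag <-] [iak <-] dis]]]] := common_prefix iwg iwk.
have ig := irreducible_catr iag; have ik := irreducible_catr iak.
pose x v := top v (pile_of ug); pose y v := top v (pile_of uk).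
pose C := [set v | (x v != 1) && (y v != 1)]%SET.
have xC v : v \in C -> x v != 1 by rewrite inE => /andP[].
have yC v : v \in C -> y v != 1 by rewrite inE => /andP[].
have cC u v : u \in C -> v \in C -> u != v -> E u v.
  by move=> /xC xu /xC xv uv; apply: (top_adjacent ig).
have [|b [ib eb]] := peel_letters ig (enum_uniq (mem C)).
  by move=> v; rewrite mem_enum; apply: xC.
have [|c [ic ec]] := peel_letters ik (enum_uniq (mem C)).
  by move=> v; rewrite mem_enum; apply: yC.
have clC : clique E C.
  apply/forall_inP => u uC; apply/forall_inP => v vC; apply/implyP.
  exact: cC.
exists C, x, y, a, b, c; split=> //.
- split; first exact: irreducible_replace iag ib (esym eb).
  by rewrite !(word_prod_cat a) eb.
- split; first exact: irreducible_replace iak ic (esym ec).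
  by rewrite !(word_prod_cat a) ec.
- apply: irreducible_triangle => // [v vC|v].
    by apply: contraNneq (xC v vC) => /dis /eqP.
  rewrite -{1}(tag_letters (enum C) x) -{2}(tag_letters (enum C) y) -!map_cat.
  rewrite -blocked_top// -blocked_top// (irreducible_pile_eq ib ig eb).
  by rewrite (irreducible_pile_eq ic ik ec) inE => -> ->.
- apply: word_prod_letters_div; first exact: enum_uniq.
  by move=> u v; rewrite !mem_enum; apply: cC.
Qed.

(** * Counting prefixes *)

Definition prefix_of (n : nat) (g p : graph_product E G) : Prop :=
  exists w1 w2, [/\ irreducible (w1 ++ w2), word_prod E (w1 ++ w2) = g,
                    word_prod E w1 = p & (size w1 <= n)%N].

(** Choose for every vector of syllable counts a prefix of g with these counts,
    if there is one; by [prefix_unique] every prefix is chosen. *)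
Lemma prefixes_enum n (g : graph_product E G) :
  exists F : {ffun V -> 'I_n.+1} -> graph_product E G,
    prefix_of n g `<=` range F.
Proof.
pose has_counts (m : {ffun V -> 'I_n.+1}) (h : graph_product E G) :=
  exists w1 w2,
  [/\ irreducible (w1 ++ w2), word_prod E (w1 ++ w2) = g,
      word_prod E w1 = h & forall v, count_mem v (map tag w1) = m v].
exists (fun m => xget 1 (has_counts m)) => p [w1 [w2 [i12 e12 <- s1]]].
pose m := [ffun v => inord (count_mem v (map tag w1)) : 'I_n.+1].
have mE v : count_mem v (map tag w1) = m v.
  rewrite ffunE inordK// ltnS (leq_trans _ s1)// -(size_map tag).
  exact: count_size.
exists m => //.
case: xgetP => [q _ [w1' [w2' [i12' e12' <- m']]]|/(_ (word_prod E w1))].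
  apply: esym; apply: (proj2 (prefix_unique i12 i12' _ _)).
    by apply: irreducible_pile_eq => //; rewrite e12'.
  by move=> v; rewrite mE m'.
by case; exists w1, w2.
Qed.

Lemma prefix_of_le n n' g h :
  (n <= n')%N -> prefix_of n g h -> prefix_of n' g h.
Proof.
move=> nn' [w1 [w2 [i e1 e2 s]]]; exists w1, w2; split=> //.
exact: leq_trans nn'.
Qed.

Lemma prefix_of_word w1 w2 n : irreducible (w1 ++ w2) -> (size w1 <= n)%N ->
  prefix_of n (word_prod E (w1 ++ w2)) (word_prod E w1).
Proof. by move=> i s; exists w1, w2. Qed.

Lemma clique_subgroup_letters (C : {set V}) T x : {subset T <= C} ->
  clique_subgroup C (word_prod E (letters T x)).
Proof.
have [C1 CM _] := subgroup_generated_subgroup [set g : graph_product E G |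
  exists2 v : V, v \in C & exists a : G v, g = gp_incl E a].
elim: T => [_|v T IH TC] /=; first by rewrite word_prod_nil.
rewrite word_prod_cons; apply: CM; rewrite inE.
  by move=> H [_]; apply; exists v; [apply: TC; rewrite mem_head|exists (x v)].
by apply: IH => u uT; apply: TC; rewrite inE uT orbT.
Qed.

End Piles.

(** * Lengths and the centroid triple *)

Section Lengths.
Local Open Scope ring_scope.
Variables (R : realType) (V : finType) (E : rel V) (G : V -> groupType).
Hypotheses (E_sym : symmetric E) (E_irr : irreflexive E).
Variable L : forall v, G v -> R.
Hypothesis L_ge0 : forall v (a : G v), 0 <= L a.
Implicit Types (w : word G) (g k : graph_product E G).

Lemma syllable_length_irreducible w :
  irreducible E w -> syllable_length (word_prod E w) = size w.
Proof.
move=> /(irreducible_reduced_word E_sym E_irr)/perm_size <-.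
by rewrite /reduced_word; case: cid => w' /= [].
Qed.

(** The length can be computed on any irreducible word, because the chosen
    reduced word is a shuffle of it. *)
Lemma graph_length_irreducible w : irreducible E w ->
  graph_length L (word_prod E w) =
  \sum_(s <- w) L (tagged s) + (size w)%:R.
Proof.
move=> iw; rewrite /graph_length syllable_length_irreducible//; congr (_ + _).
exact: (perm_big _ (irreducible_reduced_word E_sym E_irr iw)).
Qed.

Lemma syllable_length_le g : (syllable_length g)%:R <= graph_length L g.
Proof. by rewrite lerDr; apply: sumr_ge0. Qed.

Lemma graph_length_ge0 g : 0 <= graph_length L g.
Proof. exact: le_trans (ler0n _ _) (syllable_length_le g). Qed.

Lemma graph_length_factor w1 w2 w3 : irreducible E (w1 ++ w2 ++ w3) ->
  graph_length L (word_prod E w2) <=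
  graph_length L (word_prod E (w1 ++ w2 ++ w3)).
Proof.
move=> i; have i2 := irreducible_catl E_irr (irreducible_catr E_irr i).
rewrite !graph_length_irreducible// !big_cat !size_cat /=; apply: lerD.
  rewrite addrCA lerDl addr_ge0//; exact: sumr_ge0.
by rewrite ler_nat addnCA leq_addr.
Qed.

(** The four conditions on a centroid map, for one pair (g, k), expressed by
    prefixes; these bounds no longer mention how the triple was found. *)
Lemma centroid_triple g k :
  exists (C : {C : {set V} | clique E C})
         (t : graph_product E G * graph_product E G * graph_product E G),
  let: (a, b, c) := t in let n := syllable_length g in
  [/\ coset_triples (clique_subgroup (val C)) t,
      prefix_of n g a /\ prefix_of n g b,
      prefix_of n k a /\ prefix_of n k c,
      prefix_of n (g^-1 * k)%g (g^-1 * b)%g /\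
      prefix_of n (g^-1 * k)%g (g^-1 * c)%g &
      [/\ dist (graph_length L) a b <= graph_length L g,
          dist (graph_length L) a c <= graph_length L k &
          dist (graph_length L) b c <= graph_length L (g^-1 * k)%g]].
Proof.
have [C [x [y [wa [wb [wc [cC [ig eg] [ik ek] ih ez]]]]]]] :=
  centroid_decomposition E_sym E_irr g k.
move: ih ez; set Z := letters _ _ => ih ez.
set X := letters (enum C) x in ig eg ez.
set Y := letters (enum C) y in ik ek ez.
pose al := word_prod E wa; pose be := word_prod E (wa ++ X).
pose ga := word_prod E (wa ++ Y).
have sXY : size X = size Y by rewrite !size_map.
have sXZ : size X = size Z by rewrite !size_map.
have sg : syllable_length g = (size wa + size X + size wb)%N.
  by rewrite -eg syllable_length_irreducible// !size_cat addnA.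
have gE : g = (be * word_prod E wb)%g by rewrite -eg catA word_prod_cat.
have kE : k = (ga * word_prod E wc)%g by rewrite -ek catA word_prod_cat.
have gb : (g^-1 * be)%g = word_prod E (word_inv wb).
  by rewrite word_prod_inv gE invgM mulgVK.
have bc : (be^-1 * ga)%g = word_prod E Z.
  by rewrite ez /be /ga !word_prod_cat invgM -mulgA mulKg.
have gc : (g^-1 * ga)%g = word_prod E (word_inv wb ++ Z).
  by rewrite word_prod_cat -gb -bc mulgA mulgK.
have hE : (g^-1 * k)%g = word_prod E (word_inv wb ++ Z ++ wc).
  by rewrite catA word_prod_cat -gc kE mulgA.
have swb : size (word_inv wb) = size wb by rewrite size_rev size_map.
exists (exist _ C cC), (al, be, ga); split.
- exists al, 1%g, (word_prod E X), (word_prod E Y); split=> /=.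
  + by have [] := subgroup_generated_subgroup [set g : graph_product E G |
      exists2 v : V, v \in C & exists a : G v, g = gp_incl E a].
  + by apply: clique_subgroup_letters => v; rewrite mem_enum.
  + by apply: clique_subgroup_letters => v; rewrite mem_enum.
  + by rewrite mulg1 /be /ga !word_prod_cat.
- split; rewrite -{2}eg.
    by apply: prefix_of_word => //; rewrite sg -addnA leq_addr.
  rewrite catA; apply: prefix_of_word; first by rewrite -catA.
  by rewrite sg size_cat leq_addr.
- split; rewrite -{1}ek.
    by apply: prefix_of_word => //; rewrite sg -addnA leq_addr.
  rewrite catA; apply: prefix_of_word; first by rewrite -catA.
  by rewrite sg size_cat -sXY leq_addr.
- split; rewrite hE.
    by rewrite gb; apply: prefix_of_word => //; rewrite sg swb leq_addl.
  rewrite gc catA; apply: prefix_of_word; first by rewrite -catA.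
  by rewrite sg size_cat swb -sXZ -addnA [(size X + _)%N]addnC leq_addl.
- rewrite /dist bc hE.
  have -> : (al^-1 * be)%g = word_prod E X by rewrite /be word_prod_cat mulKg.
  have -> : (al^-1 * ga)%g = word_prod E Y by rewrite /ga word_prod_cat mulKg.
  by split; rewrite -?eg -?ek; apply: graph_length_factor.
Qed.

End Lengths.

(** * Polynomial bounds *)

Section Bounds.
Local Open Scope ring_scope.
Variable R : realType.

Lemma card_at_most_range (T : finType) (U : choiceType) (F : T -> U)
    (A : set U) (x : R) :
  A `<=` range F -> #|T|%:R <= x -> card_at_most A x.
Proof.
move=> AF Tx; have finF : finite_set (range F).
  by apply: finite_image; exact: finite_finset.
split; first exact: sub_finite_set finF.
apply: le_trans Tx; rewrite ler_nat.
have sub : (fset_set A `<=` [fset F m | m in T])%fset.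
  apply/fsubsetP => u; rewrite in_fset_set; last exact: sub_finite_set finF.
  by rewrite inE => /AF[m _ <-]; apply/imfsetP; exists m.
apply: leq_trans (fsubset_leq_card sub) _.
apply: leq_trans (leq_imfset_card _ _ _) _.
by rewrite cardE.
Qed.

Definition count_poly (n : nat) : {poly R} := ('X + 1) ^+ n + 'X.

Lemma count_poly_nonneg n : nonneg_coefs (count_poly n).
Proof.
move=> i; rewrite /count_poly exprD1n coefD coefX coef_sum addr_ge0//.
by apply: sumr_ge0 => j _; rewrite coefMn coefXn mulrn_wge0.
Qed.

Lemma count_polyE n r : (count_poly n).[r] = (r + 1) ^+ n + r.
Proof. by rewrite /count_poly !hornerE. Qed.

End Bounds.

(** * The relative centroid property *)

Section CountPrefixes.
Local Open Scope ring_scope.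
Variables (R : realType) (V : finType) (E : rel V) (G : V -> groupType).
Hypotheses (E_sym : symmetric E) (E_irr : irreflexive E).

Lemma card_prefix_pairs (g : graph_product E G) (r : R)
    (A : set (graph_product E G * graph_product E G)) : 0 <= r ->
  (forall q, A q -> exists n,
     [/\ n%:R <= r, prefix_of n g q.1 & prefix_of n g q.2]) ->
  card_at_most A (count_poly R (#|V| + #|V|)).[r].
Proof.
move=> r0 hA; set n := Num.truncn r.
have [F hF] := prefixes_enum E_sym E_irr n g.
apply: (@card_at_most_range R _ _ (fun m => (F m.1, F m.2))).
  move=> [q1 q2] /hA[n' [n'r /= p1 p2]].
  have nn : (n' <= n)%N by rewrite /n truncn_ge_nat.
  have [m1 _ <-] := hF _ (prefix_of_le nn p1).
  by have [m2 _ <-] := hF _ (prefix_of_le nn p2); exists (m1, m2).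
rewrite card_prod !card_ffun !card_ord -expnD count_polyE.
apply: (@le_trans _ _ ((r + 1) ^+ (#|V| + #|V|))); last by rewrite lerDl.
rewrite natrX lerXn2r ?nnegrE ?ler0n ?addr_ge0//.
by rewrite -natr1 lerD2r; have /andP[] := truncn_itv r0.
Qed.

End CountPrefixes.

Theorem theorem3p24 (R : realType) (V : finType) (E : rel V)
    (E_sym : symmetric E) (E_irr : irreflexive E)
    (G : V -> groupType) (G_countable : forall v, countable [set: G v])
    (L : forall v, G v -> R) (L_length : forall v, length_function (L v)) :
  relative_centroid_property (@graph_length R V E G L)
    (fun C : {C : {set V} | clique E C} => @clique_subgroup V E G (val C)).
Proof.
have L0 v (a : G v) : (0 <= L v a)%R by case: (L_length v).
have [C CP] := choice (fun gk => centroid_triple E_sym E_irr L0 gk.1 gk.2).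
have [rc rcP] := choice CP.
have lenP := syllable_length_le (E := E) L0.
have le_poly x n : (0 <= x)%R -> (x <= (count_poly R n).[x])%R.
  by move=> x0; rewrite count_polyE lerDr exprn_ge0// addr_ge0.
have len0 := graph_length_ge0 (E := E) L0.
exists (fun g k => rc (g, k)), (count_poly R (#|V| + #|V|)); split.
- exact: count_poly_nonneg.
- move=> g k; exists (C (g, k)) => //.
  by have := rcP (g, k); case: (rc (g, k)) => -[a b] c [].
- move=> r /ltW r0; split.
  + move=> k; apply: (card_prefix_pairs E_sym E_irr (g := k)) => // -[a c].
    move=> [g [b [gr e]]]; exists (syllable_length g).
    have := rcP (g, k); rewrite e /= => -[_ _ [pa pc] _ _]; split=> //.
    exact: le_trans (lenP g) gr.
  + move=> g; apply: (card_prefix_pairs E_sym E_irr (g := g)) => // -[a b].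
    move=> [k [c e]]; exists (syllable_length g).
    by have := rcP (g, k); rewrite e /= => -[_ [pa pb] _ _ _]; split.
  + move=> h; apply: (card_prefix_pairs E_sym E_irr (g := h)) => // -[p q].
    move=> [g [a [b [c [gr e ->]]]]]; exists (syllable_length g).
    have := rcP (g, g * h)%g; rewrite e /= mulKg => -[_ _ _ [pb pc] _].
    by split=> //; apply: le_trans (lenP g) gr.
  + move=> g k a b c e.
    have := rcP (g, k); rewrite e /= => -[_ _ _ _ [ab ac bc]].
    by split; [apply: le_trans ab _|apply: le_trans ac _|apply: le_trans bc _];
      apply: le_poly.
Qed.
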